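(* Let $D$ be a Go-diagram. There are bijections $f_1:\mathfrak D(D)\to\mathfrak R(D)$ and $f_2:\mathfrak D(D)\to\mathfrak R^\star(D)$, where for a restricted diagram $E\in\mathfrak D(D)$, $f_1(E)$ (resp. $f_2(E)$) is the system consisting of the pipes coming from the left (resp. north) boundary of the pipe dream corresponding to $E$.
   Context: **Partitions and pipe dreams.** Let $k\le n$ be natural numbers and $\lambda=(\lambda_1\ge\dots\ge\lambda_k\ge 0)$ a partition with $\lambda_1\le n-k$, identified with its Young diagram (English notation) in the top-left corner of a rectangle with $k$ rows and $n-k$ columns. The south-east border of $\lambda$ is the lattice path from the north-east corner to the south-west corner of the rectangle bounding $\lambda$; its $n$ unit edges are labelled $1,\dots,n$ starting from the north-east end. The north-west border consists of the top side of the rectangle ($n-k$ edges, the north boundary) and its left side ($k$ edges, the west or left boundary). For cells $b,c$ write $b\prec c$ if $c$ is weakly north-west of $b$, and $c_{in}=\{b: b\prec c\}$. A pipe dream on $\lambda$ is a filling of every cell by a crossing tile or an elbow tile. Pipe $j$ starts at the south-east border edge labelled $j$ and travels to the north-west border: it enters each cell through its east or south edge; in a crossing tile east continues to west and south continues to north; in an elbow tile east turns to north and south turns to west. Each edge of the north-west border is labelled by the index of the pipe exiting there; reading these labels from the north-east corner to the south-west corner (top side right to left, then left side top to bottom) gives the permutation of the pipe dream. Given a pipe dream, write $+$ in each elbow cell; in a crossing cell write $\circ$ (white stone) if the pipe entering from the east has the smaller index of the two pipes, and $\bullet$ (black stone) if the pipe entering from the east has the larger index. A pipe dream is a Go-diagram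 if in no elbow cell the pipe entering from the east has larger index than the pipe entering from the south. **Restricted and dual restricted paths.** The edges of the north-west border are sources, those of the south-east border are sinks. A restricted path (resp. dual restricted path) on $D$ goes from a source to a sink along the pipes of $D$ (traversed from the north-west border towards the south-east border), following the pipe it is on, except that upon entering a cell with $+$ or $\bullet$ in $D$ it may alternatively jump to the other pipe of that cell provided that pipe has the lower (resp. higher) index. $\mathfrak R(D)$ is the set of non-intersecting systems of $k$ restricted paths, one starting at each source on the west boundary; $\mathfrak R^\star(D)$ is the set of non-intersecting systems of $n-k$ dual restricted paths, one starting at each source on the north boundary. Non-intersecting means that no two paths of the system share a segment of a pipe (a unit edge); two paths may pass through the same cell. **Restricted diagrams.** A $(+,\circ)$ diagram is a filling of $\lambda$ by $+$ (elbow tile) and $\circ$ (crossing tile), regarded as a pipe dream. $D$ is regarded as a $(+,\circ)$ diagram by decolouring its black stones to $\circ$. Toggling a cell exchanges $+$ and $\circ$ in it. In a $(+,\circ)$ diagram $E$ with some cells marked as toggled, a cell $p$ is togglable if: (1) toggling $p$ swaps $b$ and $c$, where $b$ is the label of a pipe on the west boundary and $c$ is a label on the north boundary ($b,c$ being the two pipes through $p$); (2) toggling $p$ increases the length of the permutation of the diagram; (3) no toggled cell lies in $p_{in}$. Additionally, all cells with a white stone in $D$ are declared untogglable. After toggling $p$, the toggled cells are the previously toggled cells together with $p$. A restricted diagram obtained from $D$ is a diagram $E$ for which there is a sequence $D=E_0,E_1,\dots,E_m=E$, with no cell of $E_0$ toggled and each $E_{i+1}$ obtained from $E_i$ by toggling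 a togglable cell. $\mathfrak D(D)$ is the set of all restricted diagrams obtained from $D$. *)

(* Defs.v *)
From HB Require Import structures.
From mathcomp Require Import all_boot.
From mathcomp Require Import classical_sets functions.

Set Implicit Arguments.
Unset Strict Implicit.
Unset Printing Implicit Defensive.

Inductive tile := Cross | Elbow.

Definition tile_is_elbow (t : tile) : bool := if t is Elbow then true else false.
Definition tile_of_bool (b : bool) : tile := if b then Elbow else Cross.
Lemma tile_is_elbowK : cancel tile_is_elbow tile_of_bool. Proof. by case. Qed.
HB.instance Definition _ := Finite.copy tile (can_type tile_is_elbowK).

(* Unit edges of the grid, rows and columns being counted from 0 starting at
   the north-west corner: [Horiz i j] is the north side and [Vert i j] the west
   side of the box in row i and column j. *)
Inductive edge := Horiz of nat & nat | Vert of nat & nat.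

Definition edge_to_sum (e : edge) : nat * nat + nat * nat :=
  match e with Horiz i j => inl (i, j) | Vert i j => inr (i, j) end.
Definition edge_of_sum (s : nat * nat + nat * nat) : edge :=
  match s with inl p => Horiz p.1 p.2 | inr p => Vert p.1 p.2 end.
Lemma edge_to_sumK : cancel edge_to_sum edge_of_sum. Proof. by case. Qed.
HB.instance Definition _ := Countable.copy edge (can_type edge_to_sumK).

(* Number of inversions of a word. *)
Definition inversions (w : seq nat) : nat :=
  #|[set ab : 'I_(size w) * 'I_(size w) |
      (ab.1 < ab.2) && (nth 0 w ab.2 < nth 0 w ab.1)]|.

(* The diagram has k rows (possibly empty) of lengths [la i], in a rectangle
   with k rows and m columns; [m] is n - k. *)
Section Diagrams.
Variables (k m : nat) (la : 'I_k -> 'I_m.+1).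

Definition is_partition : Prop := forall i j : 'I_k, i <= j -> la j <= la i.

Definition cell : finType := {c : 'I_k * 'I_m | c.2 < la c.1}.

Definition row (c : cell) : nat := (val c).1.
Definition col (c : cell) : nat := (val c).2.

Definition north (c : cell) : edge := Horiz (row c) (col c).
Definition west (c : cell) : edge := Vert (row c) (col c).
Definition south (c : cell) : edge := Horiz (row c).+1 (col c).
Definition east (c : cell) : edge := Vert (row c) (col c).+1.

Definition weakly_NW (c b : cell) : bool := (row c <= row b) && (col c <= col b).
(* c_in = {b : b ≺ c} *)
Definition cell_in (c : cell) : {set cell} := [set b | weakly_NW c b].

Definition west_boundary (i : 'I_k) : edge := Vert i 0.
Definition north_boundary (j : 'I_m) : edge := Horiz 0 j.
Definition nw_border (e : edge) : bool :=
  (e \in codom west_boundary) || (e \in codom north_boundary).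

Definition col_height (j : 'I_m) : nat := #|[set i : 'I_k | j < la i]|.
Definition se_border (e : edge) : bool :=
  [exists i : 'I_k, e == Vert i (la i)] ||
  [exists j : 'I_m, e == Horiz (col_height j) j].

(* Label (from 1 to k + m) of an edge of the south-east border: the number of
   unit steps from the north-east corner of the rectangle to the far end of
   the edge. *)
Definition border_label (e : edge) : nat :=
  match e with
  | Horiz i j => i + (m - j)
  | Vert i j => i.+1 + (m - j)
  end.

(* A pipe dream, or equivalently a (+,o) diagram. *)
Definition pipe_dream : Type := {ffun cell -> tile}.

(* [e] being the north or west side of [c], the side of [c] (south or east)
   through which the pipe of [D] containing [e] enters [c] when it is travelled
   from the south-east border; [strand] thus follows pipes backwards. *)
Definition strand (D : pipe_dream) (c : cell) (e : edge) : edge :=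
  match D c with
  | Cross => if e == west c then east c else south c
  | Elbow => if e == west c then south c else east c
  end.

(* The cell having [e] as north or west side, if any. *)
Definition cell_behind (e : edge) : option cell :=
  [pick c : cell | (e == north c) || (e == west c)].

Fixpoint trace (D : pipe_dream) (fuel : nat) (e : edge) : seq edge :=
  e :: (if fuel is fuel'.+1 then
          if cell_behind e is Some c then trace D fuel' (strand D c e) else [::]
        else [::]).

(* The part of a pipe between its edge [e] and the south-east border, listed
   from [e] on.  Every step goes east or south, so fuel k + m is never
   exhausted. *)
Definition pipe_from (D : pipe_dream) (e : edge) : seq edge := trace D (k + m) e.

(* The index of the pipe of [D] through [e]. *)
Definition pipe_index (D : pipe_dream) (e : edge) : nat :=
  border_label (last e (pipe_from D e)).

Definition north_labels (D : pipe_dream) : seq nat :=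
  rev [seq pipe_index D (north_boundary j) | j <- enum 'I_m].
Definition west_labels (D : pipe_dream) : seq nat :=
  [seq pipe_index D (west_boundary i) | i <- enum 'I_k].

(* The permutation of a pipe dream, in one-line notation. *)
Definition permutation (D : pipe_dream) : seq nat :=
  north_labels D ++ west_labels D.

(* Indices of the two pipes entering [c] (from the east, from the south). *)
Definition east_pipe (D : pipe_dream) (c : cell) : nat := pipe_index D (east c).
Definition south_pipe (D : pipe_dream) (c : cell) : nat := pipe_index D (south c).

Definition plus (D : pipe_dream) (c : cell) : bool := D c == Elbow.
Definition white (D : pipe_dream) (c : cell) : bool :=
  (D c == Cross) && (east_pipe D c < south_pipe D c).
Definition black (D : pipe_dream) (c : cell) : bool :=
  (D c == Cross) && (south_pipe D c < east_pipe D c).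

Definition go_diagram (D : pipe_dream) : Prop :=
  forall c : cell, D c = Elbow -> ~ (south_pipe D c < east_pipe D c).

(* One step, through a cell [c], of a path on [D] going from the north-west to
   the south-east border; [r new old] is the condition on indices allowing a
   jump from pipe [old] to pipe [new]. *)
Definition path_step (r : rel nat) (D : pipe_dream) (e e' : edge) : bool :=
  [exists c : cell,
    ((e == north c) || (e == west c)) &&
    ((e' == strand D c e) ||
     [&& plus D c || black D c,
         e' \in [:: south c; east c], e' != strand D c e &
         r (pipe_index D e') (pipe_index D e)])].

Definition is_path (r : rel nat) (D : pipe_dream) (p : seq edge) : bool :=
  if p is e :: q then
    [&& nw_border e, path (path_step r D) e q & se_border (last e q)]
  else false.

Definition restricted_path : pipe_dream -> seq edge -> bool := is_path ltn.
Definition dual_restricted_path : pipe_dream -> seq edge -> bool := is_path gtn.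

Definition starts_at (e : edge) (p : seq edge) : bool := ohead p == Some e.

Definition non_intersecting (I : finType) (S : {ffun I -> seq edge}) : Prop :=
  forall i j : I, i != j -> forall e : edge, ~ (e \in S i /\ e \in S j).

(* A system with exactly one path from each source of a boundary is given as
   the function sending a source (its row or column) to its path. *)
Definition restricted_systems (D : pipe_dream) : set {ffun 'I_k -> seq edge} :=
  [set S : {ffun 'I_k -> seq edge} |
    (forall i : 'I_k,
       restricted_path D (S i) /\ starts_at (west_boundary i) (S i)) /\
    non_intersecting S]%classic.

Definition dual_restricted_systems (D : pipe_dream) :
    set {ffun 'I_m -> seq edge} :=
  [set S : {ffun 'I_m -> seq edge} |
    (forall j : 'I_m,
       dual_restricted_path D (S j) /\ starts_at (north_boundary j) (S j)) /\
    non_intersecting S]%classic.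

Definition toggle (E : pipe_dream) (p : cell) : pipe_dream :=
  [ffun c => if c == p then (if E c is Cross then Elbow else Cross) else E c].

Definition swap (b c x : nat) : nat :=
  if x == b then c else if x == c then b else x.

(* [T] is the set of toggled cells of [E]. *)
Definition togglable (D E : pipe_dream) (T : {set cell}) (p : cell) : Prop :=
  [/\ exists b c : nat,
        [/\ perm_eq [:: b; c] [:: east_pipe E p; south_pipe E p],
            b \in west_labels E, c \in north_labels E &
            permutation (toggle E p) = [seq swap b c x | x <- permutation E]],
      inversions (permutation E) < inversions (permutation (toggle E p)),
      [disjoint T & cell_in p] &
      ~~ white D p].

Inductive toggle_reachable (D : pipe_dream) : pipe_dream -> {set cell} -> Prop :=
| Reach_start : toggle_reachable D D finset.set0
| Reach_toggle (E : pipe_dream) (T : {set cell}) (p : cell) :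
    toggle_reachable D E T -> togglable D E T p ->
    toggle_reachable D (toggle E p) (p |: T).

Definition restricted_diagrams (D : pipe_dream) : set pipe_dream :=
  [set E | exists T : {set cell}, toggle_reachable D E T]%classic.

(* The pipes of [E] ending on the west (resp. north) boundary, each listed from
   that boundary to the south-east border. *)
Definition west_pipes (E : pipe_dream) : {ffun 'I_k -> seq edge} :=
  [ffun i => pipe_from E (west_boundary i)].
Definition north_pipes (E : pipe_dream) : {ffun 'I_m -> seq edge} :=
  [ffun j => pipe_from E (north_boundary j)].

End Diagrams.

(* Main.v *)
Require Import Defs.
From mathcomp Require Import all_boot perm.
From mathcomp Require Import classical_sets functions.
From mathcomp Require Import zify.

(** Both bijections come from one description of the restricted diagrams.
Colour the edges of a pipe dream [E] by the boundary, west or north, from which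
their pipe comes, and call a cell free for [E] when the pipe at its west side
comes from the west boundary, the pipe at its north side comes from the north
boundary, and its stone in [D] is not white.  Let X be the set of the [E] that
differ from [D] in free cells only ([west_changes]).

Restricted diagrams are X ([restricted_diagrams_changes]).  A toggle never has an
earlier toggled cell to its south-east, so a cell [p] about to be toggled still
sees [D] below it, hence the two pipes through [p] carry the indices they have
in [D].  Exchanging a label of the west boundary with one of the north boundary
adds inversions exactly when the west one is the larger
([inversions_swap]).  In a Go-diagram a cell is not white exactly when the pipe
at its west side has a larger index than the pipe at its north side
([nonwhite_order]).  So [p] is togglable iff it is free ([togglableP]).  The
colours at [p] depend only on cells to its north-west, which later toggles leave
alone; therefore every toggled cell is still free at the end, and conversely
the changes made by an element of X can be performed in order of increasing
depth.

X is also in bijection with either kind of path system ([pipes_bij]).  By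
[nonwhite_order] again, a restricted path may leave its pipe only on entering
a cell from the west, and a dual restricted path only on entering it
from the north.  Given a non-intersecting system, consider a cell.  If both of
its entering edges are used, both exits are used too, and one of the two paths
has no choice, so neither jumps.  If only the edge without choice is used, the
path follows [D].  If only the other edge is used, the path picks an exit
freely in a non-white cell: this is the free cell, and the choice of exit is the
choice of a tile.  Reading off these tiles gives the [E] whose pipes are the given
system. *)

Set Implicit Arguments.
Unset Strict Implicit.
Unset Printing Implicit Defensive.

(** * Edges and cells of the diagram *)

Definition depth (e : edge) : nat :=
  match e with Horiz i j => i + j | Vert i j => i + j end.

Lemma card_ord_below (k n : nat) : n <= k -> #|[set x : 'I_k | x < n]| = n.
Proof.
move=> nk; rewrite -sum1_card; under eq_bigl do rewrite inE.
by rewrite -(big_ord_widen _ (fun=> 1)) // sum1_card card_ord.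
Qed.

Lemma depth_path_inj e q x y : path (fun u v => depth u < depth v) e q ->
  x \in e :: q -> y \in e :: q -> depth x = depth y -> x = y.
Proof.
elim: q e => [|e' q IH] e /=; first by rewrite !inE => _ /eqP -> /eqP ->.
case/andP=> he hq; have lt z : z \in e' :: q -> depth e < depth z.
  have tr : transitive (fun u v => depth u < depth v) by move=> ? ? ?; exact: ltn_trans.
  rewrite inE => /predU1P[->//|hz].
  by have /allP/(_ _ hz) := order_path_min tr hq; exact: ltn_trans.
rewrite ![_ \in e :: _]in_cons => /predU1P[->|hx] /predU1P[->|hy] //.
- by have := lt _ hy; lia.
- by have := lt _ hx; lia.
exact: IH hq hx hy.
Qed.

Section Wiring.
Variables (k m : nat) (la : 'I_k -> 'I_m.+1).

Implicit Types (c p : cell la) (e b : edge) (E F : pipe_dream la).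

Definition entry c e : bool := (e == north c) || (e == west c).
Definition exit c e : bool := (e == south c) || (e == east c).

Lemma cell_eq c c' : row c = row c' -> col c = col c' -> c = c'.
Proof.
by case: c c' => [[i j] h] [[i' j'] h']; rewrite /row /col /= => /val_inj hi /val_inj hj;
   apply/val_inj; rewrite /= hi hj.
Qed.

Lemma north_entry c : entry c (north c). Proof. by rewrite /entry eqxx. Qed.
Lemma west_entry c : entry c (west c). Proof. by rewrite /entry eqxx orbT. Qed.
Lemma south_exit c : exit c (south c). Proof. by rewrite /exit eqxx. Qed.
Lemma east_exit c : exit c (east c). Proof. by rewrite /exit eqxx orbT. Qed.

Lemma entry_cell c c' e : entry c e -> entry c' e -> c = c'.
Proof. by case/orP => /eqP -> /orP[] /eqP [] *; apply: cell_eq. Qed.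

Lemma exit_cell c c' e : exit c e -> exit c' e -> c = c'.
Proof. by case/orP => /eqP -> /orP[] /eqP [] *; apply: cell_eq. Qed.

Lemma entry_depth c e : entry c e -> depth e = row c + col c.
Proof. by case/orP=> /eqP ->. Qed.

Lemma exit_depth c e : exit c e -> depth e = (row c + col c).+1.
Proof. by case/orP=> /eqP -> /=; lia. Qed.

Lemma cell_depth c : (row c + col c).+1 < k + m.
Proof.
rewrite /row /col; case: (val c) => i j /=.
by have := ltn_ord i; have := ltn_ord j; lia.
Qed.

Lemma entryP e : {c | entry c e} + {forall c, ~~ entry c e}.
Proof.
case: (pickP (fun c : cell la => entry c e)) => [c h|h]; first by left; exists c.
by right=> c; rewrite h.
Qed.

Lemma exitP e : {c | exit c e} + {forall c, ~~ exit c e}.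
Proof.
case: (pickP (fun c : cell la => exit c e)) => [c h|h]; first by left; exists c.
by right=> c; rewrite h.
Qed.

(** Induction along pipes travelled towards the south-east border: every step
through a cell goes to a greater depth, and depths are bounded. *)
Lemma edge_ind_se (P : edge -> Prop) :
  (forall e, (forall c e', entry c e -> exit c e' -> P e') -> P e) ->
  forall e, P e.
Proof.
move=> IH e; have [n] := ubnP (k + m - depth e).
elim: n e => // n IHn e hn; apply: IH => c e' hc hc'; apply: IHn.
have := cell_depth c; have := entry_depth hc; have := exit_depth hc'; lia.
Qed.

(** Induction along pipes travelled towards the north-west border. *)
Lemma edge_ind_nw (P : edge -> Prop) :
  (forall e, (forall c e', exit c e -> entry c e' -> P e') -> P e) ->
  forall e, P e.
Proof.
move=> IH e; have [n] := ubnP (depth e).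
elim: n e => // n IHn e hn; apply: IH => c e' hc hc'; apply: IHn.
have := entry_depth hc'; have := exit_depth hc; lia.
Qed.

Lemma nw_border_exit c e : nw_border k m e -> ~~ exit c e.
Proof.
by case/orP=> /codomP[i ->]; rewrite /exit negb_or; apply/andP; split; apply/eqP.
Qed.

(** ** Crossing one cell *)

Lemma strand_exit E c e : exit c (strand E c e).
Proof. by rewrite /exit /strand; case: (E c); case: ifP; rewrite eqxx ?orbT. Qed.

Lemma strand_west E c : strand E c (west c) = if E c is Elbow then south c else east c.
Proof. by rewrite /strand eqxx; case: (E c). Qed.

Lemma strand_north E c : strand E c (north c) = if E c is Elbow then east c else south c.
Proof. by rewrite /strand; case: (E c). Qed.

Lemma strand_inj E c e e' :
  entry c e -> entry c e' -> strand E c e = strand E c e' -> e = e'.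
Proof.
by move=> /orP[] /eqP -> /orP[] /eqP ->; rewrite ?strand_west ?strand_north //;
   case: (E c).
Qed.

Lemma strand_onto E c e' : exit c e' -> exists2 e, entry c e & strand E c e = e'.
Proof.
have := strand_west E c; have := strand_north E c.
have := north_entry c; have := west_entry c.
by case: (E c) => hw hn sn sw /orP[] /eqP ->;
   solve [by exists (north c) | by exists (west c)].
Qed.

Lemma strand_local E F c e : E c = F c -> strand E c e = strand F c e.
Proof. by rewrite /strand => ->. Qed.

(** Replacing the tile exchanges the two exits: the new strand of one entering
edge is the old strand of the other. *)
Lemma strand_swap E F c e e' : entry c e -> entry c e' -> e != e' -> E c <> F c ->
  strand E c e = strand F c e'.
Proof.
by move=> /orP[] /eqP -> /orP[] /eqP ->; rewrite ?eqxx // ?strand_west ?strand_north => _;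
   case: (E c); case: (F c).
Qed.

(** ** Pipes *)

Lemma trace_deep E (f : nat) e : k + m <= depth e -> trace E f e = [:: e].
Proof.
case: f => [|f] //= h; rewrite /cell_behind; case: pickP => // c hc.
by have := cell_depth c; have := entry_depth hc; lia.
Qed.

(** Each step raises the depth by one, and no cell is met at depth [k + m]. *)
Lemma trace_fuel E (f1 f2 : nat) e :
  k + m <= f1 + depth e -> k + m <= f2 + depth e ->
  trace E f1 e = trace E f2 e.
Proof.
elim: f1 f2 e => [|f1 IH] f2 e h1 h2; first by rewrite !trace_deep.
case: f2 h2 => [|f2] h2; first by rewrite !trace_deep.
rewrite /= /cell_behind; case: pickP => // c hc; congr (_ :: _).
have hd := exit_depth (strand_exit E c e); have he := entry_depth hc.
by apply: IH; lia.
Qed.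

Lemma pipe_from_entry E c e :
  entry c e -> pipe_from E e = e :: pipe_from E (strand E c e).
Proof.
move=> hc; have hd := cell_depth c; have he := entry_depth hc.
have hs := exit_depth (strand_exit E c e).
rewrite /pipe_from (@trace_fuel E (k + m) (k + m).+1) /=; [|lia|lia].
rewrite /cell_behind; case: pickP => [c' hc'|/(_ c)].
  by rewrite (entry_cell hc hc').
by rewrite -/(entry c e) hc.
Qed.

Lemma pipe_from_end E e : (forall c, ~~ entry c e) -> pipe_from E e = [:: e].
Proof.
rewrite /pipe_from => h; case: (k + m) => [|f] //=.
by rewrite /cell_behind; case: pickP => // c; rewrite -/(entry c e) (negPf (h c)).
Qed.

Lemma pipe_fromE E e : pipe_from E e = e :: behead (pipe_from E e).
Proof. by rewrite /pipe_from; case: (k + m). Qed.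

Lemma mem_pipe_head E e : e \in pipe_from E e.
Proof. by rewrite /pipe_from; case: (k + m) => *; rewrite inE eqxx. Qed.

Lemma mem_pipe_trans E e e' e'' :
  e' \in pipe_from E e -> e'' \in pipe_from E e' -> e'' \in pipe_from E e.
Proof.
elim/edge_ind_se: e => e IH; case: (entryP e) => [[c hc]|h]; last first.
  by rewrite (pipe_from_end E h) inE => /eqP ->; rewrite pipe_from_end.
rewrite (pipe_from_entry E hc) inE => /predU1P[->|h1 h2]; first by rewrite (pipe_from_entry E hc).
by rewrite inE (IH c _ hc (strand_exit E c e)) ?orbT.
Qed.

Lemma pipe_index_strand E c e :
  entry c e -> pipe_index E (strand E c e) = pipe_index E e.
Proof.
by move=> hc; rewrite /pipe_index (pipe_from_entry E hc) /= pipe_fromE.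
Qed.

Lemma pipe_index_mem E e e' :
  e' \in pipe_from E e -> pipe_index E e' = pipe_index E e.
Proof.
elim/edge_ind_se: e => e IH; case: (entryP e) => [[c hc]|h]; last first.
  by rewrite pipe_from_end // inE => /eqP ->.
rewrite (pipe_from_entry E hc) inE => /predU1P[->//|h1].
by rewrite (IH c _ hc (strand_exit E c e)) ?pipe_index_strand.
Qed.

Lemma pipe_depth_path E e :
  path (fun x y => depth x < depth y) e (behead (pipe_from E e)).
Proof.
elim/edge_ind_se: e => e IH; case: (entryP e) => [[c hc]|h]; last first.
  by rewrite pipe_from_end.
rewrite (pipe_from_entry E hc) /= pipe_fromE /= (IH c _ hc (strand_exit E c e)) andbT.
by rewrite (entry_depth hc) (exit_depth (strand_exit E c e)).
Qed.

Lemma pipe_depth_inj E e x y :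
  x \in pipe_from E e -> y \in pipe_from E e -> depth x = depth y -> x = y.
Proof.
by rewrite pipe_fromE => hx hy; apply: depth_path_inj hx hy; exact: pipe_depth_path.
Qed.

(** As a tile matches its two entering edges with its two exits, a pipe reaches
the exit of a strand only by that strand, unless it starts there; no pipe
starts at an exit when it starts on the north-west border. *)
Lemma mem_pipe_strand E c e b : nw_border k m b -> entry c e ->
  (strand E c e \in pipe_from E b) = (e \in pipe_from E b).
Proof.
move=> hb hc; apply/idP/idP => [|h]; last first.
  by apply: mem_pipe_trans h _; rewrite (pipe_from_entry E hc) inE mem_pipe_head orbT.
have: ~~ exit c b by exact: nw_border_exit.
elim/edge_ind_se: b {hb} => b IH hb; case: (entryP b) => [[c' hc']|h]; last first.
  by rewrite pipe_from_end // inE => /eqP hs; rewrite -hs strand_exit in hb.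
rewrite (pipe_from_entry E hc') !inE => /predU1P[hs|h].
  by rewrite -hs strand_exit in hb.
have [hx|hx] := boolP (exit c (strand E c' b)); last first.
  by rewrite (IH c' _ hc' (strand_exit E c' b) hx h) orbT.
have hcc : c' = c by apply: exit_cell hx; exact: strand_exit.
subst c'; have h3 : strand E c b = strand E c e.
  apply: pipe_depth_inj (mem_pipe_head _ _) h _.
  by rewrite !(@exit_depth c) // strand_exit.
by rewrite (strand_inj hc' hc h3) eqxx.
Qed.

Lemma mem_pipe_start E e b :
  (forall c, ~~ exit c e) -> (e \in pipe_from E b) = (e == b).
Proof.
move=> hn; apply/idP/eqP => [|->]; last exact: mem_pipe_head.
elim/edge_ind_se: b => b IH; case: (entryP b) => [[c hc]|h].
  rewrite (pipe_from_entry E hc) inE => /predU1P[//|h1].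
  have he := IH c _ hc (strand_exit E c b) h1.
  by have := hn c; rewrite he strand_exit.
by rewrite pipe_from_end // inE => /eqP.
Qed.

Lemma pipe_source_uniq E e b b' : nw_border k m b -> nw_border k m b' ->
  e \in pipe_from E b -> e \in pipe_from E b' -> b = b'.
Proof.
move=> hb hb'; elim/edge_ind_nw: e => e IH.
case: (exitP e) => [[c hc]|h].
  have [e0 he0 <-] := strand_onto E hc.
  by rewrite !mem_pipe_strand //; exact: IH hc he0.
by rewrite !mem_pipe_start // => /eqP <- /eqP.
Qed.

(** ** Locality *)

(** The cells through which a pipe can pass before it arrives at [e]. *)
Definition before c e : bool :=
  match e with
  | Horiz i j => (row c < i) && (col c <= j)
  | Vert i j => (row c <= i) && (col c < j)
  end.
(** The cells through which a pipe can pass once it has left along [e]. *)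
Definition after c e : bool :=
  match e with
  | Horiz i j => (i <= row c) && (j <= col c)
  | Vert i j => (i <= row c) && (j <= col c)
  end.

Lemma exit_before c e : exit c e -> before c e.
Proof. by case/orP=> /eqP -> /=; rewrite ?leqnn. Qed.

Lemma before_entry c c' e e' : exit c e -> entry c e' -> before c' e' -> before c' e.
Proof. by case/orP=> /eqP -> /orP[] /eqP -> /=; lia. Qed.

Lemma entry_after c e : entry c e -> after c e.
Proof. by case/orP=> /eqP -> /=; rewrite ?leqnn. Qed.

Lemma after_exit c c' e e' : entry c e -> exit c e' -> after c' e' -> after c' e.
Proof. by case/orP=> /eqP -> /orP[] /eqP -> /=; lia. Qed.

Lemma pipe_from_local E F e : (forall c, after c e -> E c = F c) ->
  pipe_from E e = pipe_from F e.
Proof.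
elim/edge_ind_se: e => e IH h; case: (entryP e) => [[c hc]|hn]; last first.
  by rewrite !pipe_from_end.
rewrite !(pipe_from_entry _ hc) (strand_local _ (h c (entry_after hc))).
congr (_ :: _); apply: (IH c) (strand_exit F c e) _ => // c' h'.
by apply: h; apply: after_exit h'; first exact: hc; exact: strand_exit.
Qed.

Lemma pipe_index_local E F e : (forall c, after c e -> E c = F c) ->
  pipe_index E e = pipe_index F e.
Proof. by rewrite /pipe_index => /pipe_from_local ->. Qed.

Lemma mem_pipe_local E F b e : nw_border k m b ->
  (forall c, before c e -> E c = F c) ->
  (e \in pipe_from E b) = (e \in pipe_from F b).
Proof.
move=> hb; elim/edge_ind_nw: e => e IH h; case: (exitP e) => [[c hc]|hn].
  have [e0 he0 hs] := strand_onto E hc.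
  have hs' : strand F c e0 = e by rewrite -hs; apply: strand_local; rewrite h ?exit_before.
  rewrite -{1}hs -{1}hs' !mem_pipe_strand //; apply: (IH c) => // c' hc'.
  by apply: h; apply: before_entry hc'; first exact: hc.
by rewrite !mem_pipe_start.
Qed.

End Wiring.

(** * The borders, and the label of a pipe *)

Section Borders.
Variables (k m : nat) (la : 'I_k -> 'I_m.+1).
Hypothesis hla : is_partition la.

Implicit Types (c p : cell la) (e b : edge) (E F : pipe_dream la).

(** Columns are initial segments because row lengths decrease; with this, every
edge inside the shape either enters a cell or lies on the south-east border. *)
Lemma col_heightE (i : 'I_k) (j : 'I_m) : (j < la i) = (i < col_height la j).
Proof.
rewrite /col_height; apply/idP/idP => h.
  rewrite -(@card_ord_below k i.+1 (ltn_ord i)); apply: subset_leq_card.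
  by apply/fintype.subsetP=> x; rewrite !inE => hx; apply: leq_trans h _; apply: hla.
rewrite ltnNge; apply/negP => h'; move: h; apply/negP; rewrite -leqNgt.
rewrite -(@card_ord_below k i (ltnW (ltn_ord i))); apply: subset_leq_card.
apply/fintype.subsetP=> x; rewrite !inE => hx; rewrite ltnNge; apply/negP=> hix.
by have := hla hix; lia.
Qed.

Lemma col_height_le (j : 'I_m) : col_height la j <= k.
Proof. by rewrite -[X in _ <= X]card_ord; exact: max_card. Qed.

Lemma col_height_anti (j j' : 'I_m) : j <= j' -> col_height la j' <= col_height la j.
Proof.
move=> hj; apply: subset_leq_card; apply/fintype.subsetP=> x; rewrite !inE.
exact: leq_ltn_trans.
Qed.

Lemma cellI (i : 'I_k) (j : 'I_m) : j < la i -> {c : cell la | row c = i & col c = j}.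
Proof. by move=> h; exists (exist _ (i, j) h). Qed.

Definition in_diagram e : bool := nw_border k m e || [exists c : cell la, exit c e].

Lemma exit_in_diagram c e : exit c e -> in_diagram e.
Proof. by move=> h; apply/orP; right; apply/existsP; exists c. Qed.

Lemma nw_in_diagram e : nw_border k m e -> in_diagram e.
Proof. by move=> h; apply/orP; left. Qed.

Lemma west_in_nw (i : 'I_k) : nw_border k m (west_boundary i).
Proof. by apply/orP; left; exact: codom_f. Qed.

Lemma north_in_nw (j : 'I_m) : nw_border k m (north_boundary j).
Proof. by apply/orP; right; exact: codom_f. Qed.

(** The shape being a partition, the cells north and west of a cell belong to it,
so a pipe can be followed back to the north-west border. *)
Lemma entry_in_diagram c e : entry c e -> in_diagram e.
Proof.
rewrite /entry /north /west /row /col; case: c => [[i j] /= h].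
case/orP=> /eqP ->.
  have [i0|i0] := posnP i; first by rewrite i0; apply: nw_in_diagram; exact: (north_in_nw j).
  have hi : i.-1 < k by have := ltn_ord i; lia.
  have hlt : j < la (Ordinal hi) by apply: leq_trans h _; apply: hla => /=; lia.
  have [c hr hc] := cellI hlt; apply: (@exit_in_diagram c); rewrite /exit /south hr hc /=.
  by rewrite prednK // eqxx.
have [j0|j0] := posnP j; first by rewrite j0; apply: nw_in_diagram; exact: (west_in_nw i).
have hj : j.-1 < m by have := ltn_ord j; lia.
have hlt : Ordinal hj < la i by rewrite /=; lia.
have [c hr hc] := cellI hlt; apply: (@exit_in_diagram c); rewrite /exit /east hr hc /=.
by rewrite prednK // eqxx orbT.
Qed.

Lemma se_border_end c e : se_border la e -> ~~ entry c e.
Proof.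
rewrite /entry /north /west /row /col; case: c => [[i j] /= h].
case/orP=> /existsP[x /eqP ->]; apply/negP=> /orP[] /eqP // [].
  by move=> /val_inj hi hj; rewrite hi in hj; lia.
move=> hi /val_inj hj; rewrite -hj in h.
by have := col_heightE i x; rewrite h hi ltnn.
Qed.

Lemma in_diagram_end e : in_diagram e -> (forall c, ~~ entry c e) -> se_border la e.
Proof.
have vert (i : 'I_k) j : j <= la i -> (forall c, ~~ entry c (Vert i j)) -> j = la i.
  rewrite leq_eqVlt => /predU1P[//|h] hn.
  have hj : j < m by have := ltn_ord (la i); lia.
  have [c hr hc] := @cellI i (Ordinal hj) h.
  by have := hn c; rewrite /entry /west hr hc eqxx orbT.
have horiz (j : 'I_m) i : i <= col_height la j ->
    (forall c, ~~ entry c (Horiz i j)) -> i = col_height la j.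
  rewrite leq_eqVlt => /predU1P[//|h] hn.
  have hi : i < k by have := col_height_le j; lia.
  have hj : j < la (Ordinal hi) by rewrite col_heightE.
  have [c hr hc] := @cellI (Ordinal hi) j hj.
  by have := hn c; rewrite /entry /north hr hc eqxx.
rewrite /se_border; case/orP=> [/orP[] /codomP[x ->]|].
- move/(vert x 0 (leq0n _)) => h; apply/orP; left.
  by apply/existsP; exists x; rewrite -h.
- move/(horiz x 0 (leq0n _)) => h; apply/orP; right.
  by apply/existsP; exists x; rewrite -h.
case/existsP=> c; rewrite /exit /south /east /row /col; case: c => [[i j] /= h].
case/orP=> /eqP -> hn; apply/orP; [right|left]; apply/existsP.
  by exists j; rewrite -(horiz j i.+1) // -col_heightE.
by exists i; rewrite -(vert i j.+1).
Qed.

(** The labels count steps along a lattice path: going from one south-east border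
edge to a later one, one of row and distance to the east side grows and the other
does not shrink. *)
Lemma border_label_inj :
  {in se_border la &, injective (border_label m)}.
Proof.
have hv (i i' : 'I_k) : i < i' -> la i' <= la i by move/ltnW/hla.
have hh (j j' : 'I_m) : j < j' -> col_height la j' <= col_height la j by move/ltnW/col_height_anti.
have hlt (j : 'I_m) := ltn_ord j.
have hle (i : 'I_k) : la i <= m by rewrite -ltnS.
move=> e e' /orP[] /existsP[x /eqP ->] /orP[] /existsP[y /eqP ->] /= h.
- have [hxy|hxy|/val_inj -> //] := ltngtP x y.
    by have := hv _ _ hxy; lia.
  by have := hv _ _ hxy; lia.
- have := col_heightE x y; have := hlt y; have := hle x; lia.
- have := col_heightE y x; have := hlt x; have := hle y; lia.
have [hxy|hxy|/val_inj -> //] := ltngtP x y.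
  by have := hh _ _ hxy; have := hlt y; lia.
by have := hh _ _ hxy; have := hlt x; lia.
Qed.

Lemma pipe_source E e : in_diagram e -> exists2 b, nw_border k m b & e \in pipe_from E b.
Proof.
elim/(@edge_ind_nw _ _ la): e => e IH /orP[hb|/existsP[c hc]].
  by exists e; rewrite ?mem_pipe_head.
have [e0 he0 <-] := strand_onto E hc.
have [b hb h] := IH c e0 hc he0 (entry_in_diagram he0).
by exists b; rewrite ?mem_pipe_strand.
Qed.

Lemma pipe_last E e : in_diagram e -> se_border la (last e (pipe_from E e)).
Proof.
elim/(@edge_ind_se _ _ la): e => e IH he; case: (entryP la e) => [[c hc]|h].
  have hs := strand_exit E c e.
  by rewrite (pipe_from_entry E hc) /= pipe_fromE; have := IH c _ hc hs (exit_in_diagram hs);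
     rewrite pipe_fromE.
by rewrite pipe_from_end //=; exact: in_diagram_end.
Qed.

(** Pipes do not merge: two edges with the same index lie on one pipe, since
their pipes run to the same edge of the south-east border. *)
Lemma pipe_index_source E e e' b b' : in_diagram e -> in_diagram e' ->
  pipe_index E e = pipe_index E e' -> nw_border k m b -> nw_border k m b' ->
  e \in pipe_from E b -> e' \in pipe_from E b' -> b = b'.
Proof.
move=> he he' hi hb hb' hm hm'.
have lastin x : last x (pipe_from E x) \in pipe_from E x.
  by rewrite pipe_fromE /=; exact: mem_last.
have hl := border_label_inj (pipe_last E he) (pipe_last E he') hi.
apply: (pipe_source_uniq hb hb' (mem_pipe_trans hm (lastin e))).
by rewrite hl; exact: mem_pipe_trans (lastin e').
Qed.

Lemma pipe_index_nw_inj E : {in nw_border k m &, injective (pipe_index E)}.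
Proof.
move=> b b' hb hb' h.
by apply: (pipe_index_source (nw_in_diagram hb) (nw_in_diagram hb') h);
   rewrite ?mem_pipe_head.
Qed.

Lemma pipe_index_depth_inj E e e' : in_diagram e -> in_diagram e' ->
  depth e = depth e' -> pipe_index E e = pipe_index E e' -> e = e'.
Proof.
move=> he he' hd hi.
have [b hb hm] := pipe_source E he; have [b' hb' hm'] := pipe_source E he'.
have hbb := pipe_index_source he he' hi hb hb' hm hm'; subst b'.
exact: pipe_depth_inj hm hm' hd.
Qed.

(** A pipe meets each depth at most once, so it cannot use both exits of a cell. *)
Lemma exit_pipes_neq E c : east_pipe E c != south_pipe E c.
Proof.
apply/eqP=> h.
have := pipe_index_depth_inj (exit_in_diagram (east_exit c)) (exit_in_diagram (south_exit c)).
have hd : depth (east c) = depth (south c).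
  by rewrite (exit_depth (east_exit c)) (exit_depth (south_exit c)).
by move/(_ _ hd h).
Qed.

(** ** Colouring edges by the boundary their pipe comes from *)

Definition on_pipes (I : finType) (src : I -> edge) E e : bool :=
  [exists i, e \in pipe_from E (src i)].

Lemma on_pipes_strand (I : finType) (src : I -> edge) E c e :
  (forall i, nw_border k m (src i)) -> entry c e ->
  on_pipes src E (strand E c e) = on_pipes src E e.
Proof.
by move=> hsrc hc; apply: eq_existsb => i; rewrite mem_pipe_strand.
Qed.

Lemma on_pipes_local (I : finType) (src : I -> edge) E F e :
  (forall i, nw_border k m (src i)) -> (forall c, before c e -> E c = F c) ->
  on_pipes src E e = on_pipes src F e.
Proof.
by move=> hsrc h; apply: eq_existsb => i; rewrite (mem_pipe_local (hsrc i) h).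
Qed.

Definition on_west E := on_pipes (@west_boundary k) E.
Definition on_north E := on_pipes (@north_boundary m) E.

Lemma on_northE E e : in_diagram e -> on_north E e = ~~ on_west E e.
Proof.
move=> he; have [b hb hm] := pipe_source E he.
have [hw|hw] := boolP (on_west E e); last first.
  case/orP: hb hm => /codomP[x ->] hm; last by apply/existsP; exists x.
  by case/negP: hw; apply/existsP; exists x.
case/existsP: hw => i hi; apply/existsP => -[j hj].
by have := pipe_source_uniq (west_in_nw i) (north_in_nw j) hi hj.
Qed.

Lemma mem_labels (I : finType) (src : I -> edge) E e :
  (forall i, nw_border k m (src i)) -> in_diagram e ->
  (pipe_index E e \in [seq pipe_index E (src i) | i <- enum I]) = on_pipes src E e.
Proof.
move=> hsrc he; apply/mapP/existsP => [[i _ hi]|[i hi]]; exists i.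
- have [b hb hm] := pipe_source E he.
  have hs := nw_in_diagram (hsrc i).
  by rewrite -(pipe_index_source he hs hi hb (hsrc i) hm (mem_pipe_head _ _)).
- by rewrite mem_enum.
exact: pipe_index_mem.
Qed.

Lemma mem_west_labels E e :
  in_diagram e -> (pipe_index E e \in west_labels E) = on_west E e.
Proof. by move=> he; apply: mem_labels => // i; exact: west_in_nw. Qed.

Lemma mem_north_labels E e :
  in_diagram e -> (pipe_index E e \in north_labels E) = on_north E e.
Proof. by move=> he; rewrite mem_rev; apply: mem_labels => // i; exact: north_in_nw. Qed.

Lemma permutation_uniq E : uniq (permutation E).
Proof.
rewrite cat_uniq rev_uniq; apply/and3P; split.
- rewrite map_inj_in_uniq ?enum_uniq // => i j _ _.
  by move/(pipe_index_nw_inj (north_in_nw i) (north_in_nw j)) => -[] /val_inj.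
- apply/hasPn=> x /mapP[i _ ->]; rewrite /= mem_north_labels ?nw_in_diagram ?west_in_nw //.
  rewrite on_northE ?nw_in_diagram ?west_in_nw // negbK.
  by apply/existsP; exists i; exact: mem_pipe_head.
rewrite map_inj_in_uniq ?enum_uniq // => i j _ _.
by move/(pipe_index_nw_inj (west_in_nw i) (west_in_nw j)) => -[] /val_inj.
Qed.

(** ** Toggling one cell *)

Lemma toggleE E p : toggle E p p = if E p is Cross then Elbow else Cross.
Proof. by rewrite ffunE eqxx. Qed.

Lemma toggle_other E p c : c != p -> toggle E p c = E c.
Proof. by rewrite ffunE => /negPf ->. Qed.

Lemma toggleK E p : toggle (toggle E p) p = E.
Proof.
by apply/ffunP=> c; rewrite !ffunE; case: eqP => [->|//]; case: (E p).
Qed.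

Lemma before_entry_neq c e : entry c e -> ~~ before c e.
Proof. by case/orP=> /eqP -> /=; lia. Qed.

Lemma after_exit_neq c e : exit c e -> ~~ after c e.
Proof. by case/orP=> /eqP -> /=; lia. Qed.

Lemma pipe_from_avoid E p e : (forall x, entry p x -> x \notin pipe_from E e) ->
  pipe_from (toggle E p) e = pipe_from E e.
Proof.
elim/(@edge_ind_se _ _ la): e => e IH h; case: (entryP la e) => [[c hc]|hn]; last first.
  by rewrite !pipe_from_end.
have hcp : c != p by apply/eqP=> hcp; subst c; have := h e hc; rewrite mem_pipe_head.
rewrite !(pipe_from_entry _ hc) (strand_local _ (toggle_other E hcp)).
congr (_ :: _); apply: (IH c) (strand_exit E c e) _ => // x hx.
by have := h x hx; rewrite (pipe_from_entry E hc) inE negb_or => /andP[].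
Qed.

(** Up to [p] the pipe from [b] is unchanged.  If it reaches [p] it leaves
through the other exit, below which nothing changed, so it takes the index that the
other pipe had there; if it avoids [p] it is unchanged altogether. *)
Lemma pipe_index_toggle E p b : nw_border k m b ->
  pipe_index (toggle E p) b = swap (east_pipe E p) (south_pipe E p) (pipe_index E b).
Proof.
move=> hb.
have [[x hpx hx]|hn] : (exists2 x, entry p x & x \in pipe_from E b) \/
    (forall x, entry p x -> x \notin pipe_from E b).
  have [hw|hw] := boolP (west p \in pipe_from E b).
    by left; exists (west p); rewrite ?west_entry.
  have [hm|hm] := boolP (north p \in pipe_from E b).
    by left; exists (north p); rewrite ?north_entry.
  by right=> x /orP[] /eqP ->.
- have hx' : x \in pipe_from (toggle E p) b.
    rewrite (@mem_pipe_local _ _ _ (toggle E p) E b x hb) // => c hc.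
    by apply: toggle_other; apply: contraTneq hc => ->; exact: before_entry_neq.
  rewrite -(pipe_index_mem hx) -(pipe_index_mem hx') -!(pipe_index_strand _ hpx).
  rewrite (@pipe_index_local _ _ _ (toggle E p) E) => [|c hc]; last first.
    apply: toggle_other; apply: contraTneq hc => ->.
    by apply: after_exit_neq; exact: strand_exit.
  have := exit_pipes_neq E p; rewrite /east_pipe /south_pipe.
  case/orP: hpx => /eqP ->; rewrite ?strand_north ?strand_west toggleE /swap;
    case: (E p) => hne; by rewrite eqxx // eq_sym (negPf hne).
have out e : exit p e -> pipe_index E b != pipe_index E e.
  move=> he; apply/eqP => hi; have [e0 he0 hs] := strand_onto E he.
  have hin := exit_in_diagram he; have [b' hb' hm] := pipe_source E hin.
  have hbb := pipe_index_source (nw_in_diagram hb) hin hi hb hb' (mem_pipe_head _ _) hm.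
  by have := hn _ he0; rewrite hbb -(mem_pipe_strand E hb' he0) hs hm.
rewrite {1}/pipe_index (pipe_from_avoid hn) -/(pipe_index E b) /swap.
by rewrite (negPf (out _ (east_exit p))) (negPf (out _ (south_exit p))).
Qed.

Lemma permutation_toggle E p :
  permutation (toggle E p) =
  [seq swap (east_pipe E p) (south_pipe E p) x | x <- permutation E].
Proof.
rewrite /permutation map_cat /north_labels /west_labels map_rev -!map_comp.
congr (rev _ ++ _); apply: eq_map => i /=; apply: pipe_index_toggle.
  exact: north_in_nw.
exact: west_in_nw.
Qed.

Lemma swapC (a b x : nat) : swap a b x = swap b a x.
Proof. by rewrite /swap; do 2!case: eqP => // ?; subst. Qed.

End Borders.

(** * Inversions *)

Definition inversion_set (n : nat) (f : 'I_n -> nat) : {set 'I_n * 'I_n} :=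
  [set ab : 'I_n * 'I_n | (ab.1 < ab.2) && (f ab.2 < f ab.1)].

Lemma inversionsE (n : nat) (w : seq nat) :
  size w = n -> inversions w = #|inversion_set (fun x : 'I_n => nth 0 w x)|.
Proof. by move=> <-. Qed.

(** Send an inversion [(a, b)] of [f] to its image under the transposition when that
image is still increasing, and keep it otherwise.  In the second case one of [a], [b] is
[i] or [j] and the other lies strictly between, and [f i < f j] makes [(a, b)] an
inversion of [g].  This injection misses [(i, j)]. *)
Lemma inversion_set_tperm (n : nat) (f g : 'I_n -> nat) (i j : 'I_n) :
  i < j -> f i < f j -> (forall x, g x = f (tperm i j x)) ->
  #|inversion_set f| < #|inversion_set g|.
Proof.
move=> ij fij gE.
pose phi (ab : 'I_n * 'I_n) := if tperm i j ab.1 < tperm i j ab.2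
  then (tperm i j ab.1, tperm i j ab.2) else ab.
have phi_inj : {in inversion_set f &, injective phi}.
  move=> [a b] [a' b']; rewrite !inE /phi /= => /andP[ab _] /andP[ab' _].
  case: ifP => h; case: ifP => h' [e1 e2].
  - by rewrite (perm_inj e1) (perm_inj e2).
  - by move: h'; rewrite -e1 -e2 !tpermK ab.
  - by move: h; rewrite e1 e2 !tpermK ab'.
  - by rewrite e1 e2.
rewrite -(card_in_imset phi_inj); apply: proper_card; apply/properP; split.
  apply/fintype.subsetP=> _ /imsetP[[a b] + ->]; rewrite !inE /phi /= => /andP[ab fab].
  case: ifP => h /=; rewrite !gE ?tpermK ?h //.
  rewrite ab /=; move: h.
  by case: (tpermP i j a) => [?|?|? ?]; case: (tpermP i j b) => [?|?|? ?]; subst; lia.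
exists (i, j); first by rewrite inE /= !gE tpermL tpermR ij fij.
apply/imsetP=> -[[a b]]; rewrite !inE /phi /= => /andP[ab fab].
case: ifP => h [e1 e2]; last by move: fab; rewrite -e1 -e2; lia.
have ea : a = j by rewrite -[a](tpermK i j) -e1 tpermL.
have eb : b = i by rewrite -[b](tpermK i j) -e2 tpermR.
by move: ab; rewrite ea eb; lia.
Qed.

Lemma inversions_swap (u v : seq nat) (b c : nat) :
  uniq (u ++ v) -> c \in u -> b \in v ->
  (inversions (u ++ v) < inversions [seq swap b c x | x <- u ++ v]) = (c < b).
Proof.
set w := u ++ v => hw hc hb; set w' := map _ w.
have hi : index c w < size u by rewrite index_cat hc index_mem.
have hnb : b \notin u.
  by apply/negP=> h; move: hw; rewrite cat_uniq => /and3P[_ /hasPn/(_ _ hb)]; rewrite /= h.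
have hj : size u <= index b w < size w.
  rewrite index_mem mem_cat hb orbT andbT index_cat (negPf hnb); exact: leq_addr.
have hiw : index c w < size w by lia.
have hjw : index b w < size w by lia.
pose i := Ordinal hiw; pose j := Ordinal hjw.
pose f (x : 'I_(size w)) := nth 0 w x; pose g (x : 'I_(size w)) := nth 0 w' x.
have fi : f i = c by rewrite /f nth_index // -index_mem.
have fj : f j = b by rewrite /f nth_index // -index_mem.
have finj : injective f.
  by move=> x y /eqP; rewrite /f nth_uniq // => /eqP/val_inj.
have gE x : g x = f (tperm i j x).
  rewrite /g (nth_map 0) // -/(f x) /swap.
  case: tpermP => [->|->|/eqP hx /eqP hy]; rewrite ?fi ?fj ?eqxx //.
    by case: eqP.
  by rewrite -fi -fj !(inj_eq finj) (negPf hx) (negPf hy).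
have fE x : f x = g (tperm i j x) by rewrite gE tpermK.
rewrite (inversionsE (erefl (size w))) (@inversionsE (size w) w') ?size_map //.
have hij : i < j by rewrite /=; lia.
have [hlt|hgt|heq] := ltngtP c b.
- by apply: (inversion_set_tperm hij _ gE); rewrite fi fj.
(* The exchange is an involution, so the strict increase applies backwards. *)
- apply/negbTE; rewrite -leqNgt ltnW //; apply: (inversion_set_tperm hij _ fE).
  by rewrite !gE tpermL tpermR fi fj.
by rewrite heq (negPf hnb) in hc.
Qed.

(** * Path systems and modified pipe dreams *)

Lemma path_succ (T : eqType) (R : rel T) x q y : path R x q -> y \in x :: q ->
  y = last x q \/ exists2 z, z \in x :: q & R y z.
Proof.
elim: q x => [|a q IH] x /=; first by rewrite inE => _ /eqP; left.
case/andP=> hx hq; rewrite in_cons => /predU1P[->|hy].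
  by right; exists a; rewrite // !inE eqxx orbT.
case: (IH a hq hy) => [|[z hz hr]]; first by left.
by right; exists z; rewrite // in_cons hz orbT.
Qed.

Lemma path_pred (T : eqType) (R : rel T) x q y : path R x q -> y \in x :: q ->
  y = x \/ exists2 z, z \in x :: q & R z y.
Proof.
elim: q x => [|a q IH] x /=; first by rewrite inE => _ /eqP; left.
case/andP=> hx hq; rewrite in_cons => /predU1P[->|hy]; first by left.
right; case: (IH a hq hy) => [->|[z hz hr]].
  by exists x; rewrite // inE eqxx.
by exists z; rewrite // in_cons hz orbT.
Qed.

Section Systems.
Variables (k m : nat) (la : 'I_k -> 'I_m.+1).
Hypothesis hla : is_partition la.
Variables (D : pipe_dream la) (r : rel nat).

Implicit Types (c : cell la) (e : edge) (E : pipe_dream la) (p : seq edge).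

Lemma path_step_cell e e' : path_step r D e e' -> exists2 c : cell la, entry c e & exit c e'.
Proof.
case/existsP=> c /andP[hc h]; exists c => //.
case/orP: h => [/eqP ->|/and4P[_ + _ _]]; first exact: strand_exit.
by rewrite !inE.
Qed.

Lemma path_step_strand c e : entry c e -> path_step r D e (strand D c e).
Proof. by move=> hc; apply/existsP; exists c; rewrite -/(entry c e) hc eqxx. Qed.

Lemma path_step_depth e e' : path_step r D e e' -> depth e' = (depth e).+1.
Proof. by case/path_step_cell => c h h'; rewrite (exit_depth h') (entry_depth h). Qed.

Lemma is_path_depth_inj p x y : is_path r D p ->
  x \in p -> y \in p -> depth x = depth y -> x = y.
Proof.
case: p => // e q /and3P[_ hp _]; apply: depth_path_inj.
by apply: sub_path hp => a b /path_step_depth ->.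
Qed.

Lemma is_path_next p c e : is_path r D p -> e \in p -> entry c e ->
  exists e', [/\ e' \in p, path_step r D e e' & exit c e'].
Proof.
case: p => // e0 q /and3P[_ hp hl] he hc.
case: (path_succ hp he) => [hle|[z hz hs]].
  by move: hc; rewrite hle (negPf (se_border_end hla c hl)).
exists z; split=> //; have [c' hc' hx] := path_step_cell hs.
by rewrite (entry_cell hc hc').
Qed.

Lemma is_path_prev p c e : is_path r D p -> e \in p -> exit c e ->
  exists e', [/\ e' \in p, path_step r D e' e & entry c e'].
Proof.
case: p => // e0 q /and3P[hb hp _] he hc.
case: (path_pred hp he) => [hle|[z hz hs]].
  by move: hc; rewrite hle (negPf (nw_border_exit c hb)).
exists z; split=> //; have [c' hc' hx] := path_step_cell hs.
by rewrite (exit_cell hc hx).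
Qed.

(* The restricted and the dual restricted case differ only by the boundary [src]
   carrying the sources and by the entering edge, [side c], from which jumping is
   possible; on entering through [other c] a path has to stay on its pipe. *)
Variables (I : finType) (src : I -> edge) (side other : cell la -> edge).
Hypothesis src_nw : forall i, nw_border k m (src i).
Hypothesis src_inj : injective src.
Hypothesis entryE : forall c e, entry c e = (e == side c) || (e == other c).
Hypothesis side_other : forall c, side c != other c.
Hypothesis step_free :
  forall c e, ~~ white D c -> exit c e -> path_step r D (side c) e.
Hypothesis step_white :
  forall c e, white D c -> path_step r D (side c) e -> e = strand D c (side c).
Hypothesis step_other :
  forall c e, path_step r D (other c) e -> e = strand D c (other c).

Definition free_changes : set (pipe_dream la) :=
  [set E : pipe_dream la | forall c, E c <> D c ->
    [/\ ~~ white D c, on_pipes src E (side c) & ~~ on_pipes src E (other c)]]%classic.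

Definition path_systems : set {ffun I -> seq edge} :=
  [set S : {ffun I -> seq edge} |
    (forall i : I, is_path r D (S i) /\ starts_at (src i) (S i)) /\
    non_intersecting S]%classic.

Definition pipes E : {ffun I -> seq edge} := [ffun i => pipe_from E (src i)].

Let side_entry c : entry c (side c). Proof. by rewrite entryE eqxx. Qed.
Let other_entry c : entry c (other c). Proof. by rewrite entryE eqxx orbT. Qed.

Let exit_same c e e' : exit c e -> exit c e' -> depth e = depth e'.
Proof. by move=> /exit_depth -> /exit_depth ->. Qed.

Let entry_same c e e' : entry c e -> entry c e' -> depth e = depth e'.
Proof. by move=> /entry_depth -> /entry_depth ->. Qed.

Lemma pipes_system E : free_changes E -> path_systems (pipes E).
Proof.
move=> hE; split=> [i|i j hij e []]; rewrite !ffunE; last first.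
  move=> hi hj; case/eqP: hij; apply: src_inj.
  exact: pipe_source_uniq hi hj.
split; last by rewrite /starts_at pipe_fromE.
rewrite pipe_fromE /is_path src_nw /=; apply/andP; split; last first.
  have := pipe_last hla E (nw_in_diagram la (src_nw i)).
  by rewrite pipe_fromE.
have: on_pipes src E (src i) by apply/existsP; exists i; exact: mem_pipe_head.
elim/(@edge_ind_se _ _ la): (src i) => e IH hon.
case: (entryP la e) => [[c hc]|h]; last by rewrite pipe_from_end.
rewrite (pipe_from_entry E hc) /= pipe_fromE /=.
rewrite (IH c _ hc (strand_exit E c e)) ?on_pipes_strand // andbT.
have [/strand_local ->|/eqP/hE[hw hs ho]] := eqVneq (E c) (D c).
  exact: path_step_strand.
move: hc; rewrite entryE => /orP[] /eqP he; last by rewrite -he hon in ho.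
by rewrite he; apply: step_free; rewrite ?strand_exit.
Qed.

(** The system shows the colours.  In a cell where the diagrams differ, only
[side c] is used by the system, and the exit that it uses tells the tile. *)
Lemma pipes_inj E E' : free_changes E -> free_changes E' -> pipes E = pipes E' -> E = E'.
Proof.
move=> hE hE' heq.
have hp i : pipe_from E (src i) = pipe_from E' (src i).
  by have := congr1 (fun S : {ffun I -> seq edge} => S i) heq; rewrite !ffunE.
have hon e : on_pipes src E e = on_pipes src E' e by apply: eq_existsb => i; rewrite hp.
apply/ffunP=> c; apply/eqP; apply/negPn/negP => /eqP hne.
have [hs ho] : on_pipes src E (side c) /\ ~~ on_pipes src E (other c).
  have [hD|/eqP/hE[_ ? ?]] := eqVneq (E c) (D c); last by [].
  have [] := hE' c; first by rewrite -hD => /esym.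
  by rewrite -!hon.
case/negP: ho; rewrite hon -(on_pipes_strand E' src_nw (other_entry c)).
rewrite -(strand_swap (side_entry c) (other_entry c) (side_other c) hne).
by rewrite -hon on_pipes_strand.
Qed.

(** The diagram is [D], except where the system uses only [side c]; there the tile
is the one leading [side c] to the exit that the system uses.  That its pipes are the
given paths is checked edge by edge, using that an exit of a cell is used only by a path
that entered the cell. *)
Lemma pipes_onto S : path_systems S -> exists2 E, free_changes E & pipes E = S.
Proof.
move=> [hS hdisj].
have hP i : is_path r D (S i) by case: (hS i).
have disj i j e : e \in S i -> e \in S j -> i = j.
  by move=> hi hj; apply/eqP/negPn/negP=> /hdisj/(_ e); apply.
pose on e := [exists i, e \in S i].
(* The exit to which an elbow leads [side c]. *)
pose bend c : edge := if side c == west c then south c else east c.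
have bendE (E : pipe_dream la) c :
    strand E c (side c) = bend c <-> E c = Elbow.
  rewrite /bend; have := side_entry c; have := strand_west E c; have := strand_north E c.
  move=> hn hw; case/orP=> /eqP ->; rewrite ?eqxx ?hn ?hw; case: (E c) => //=.
pose E : pipe_dream la := [ffun c =>
  if on (side c) && ~~ on (other c) then (if on (bend c) then Elbow else Cross) else D c].
have follow i q e : path (path_step r D) e q -> se_border la (last e q) ->
    {subset e :: q <= S i} -> e :: q = pipe_from E e.
  elim: q e => [|e' q IH] e /=.
    by move=> _ hl _; rewrite pipe_from_end // => c; exact: se_border_end.
  case/andP=> hs hq hl hsub.
  have hsub' : {subset e' :: q <= S i}.
    by move=> x hx; apply: hsub; rewrite in_cons hx orbT.
  have he : e \in S i by apply: hsub; rewrite inE eqxx.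
  have he' : e' \in S i by apply: hsub'; rewrite inE eqxx.
  have [c hc hx] := path_step_cell hs.
  suff hE : e' = strand E c e by rewrite (pipe_from_entry E hc) (IH e' hq hl hsub') hE.
  have hEc : E c = if on (side c) && ~~ on (other c) then
      (if on (bend c) then Elbow else Cross) else D c by rewrite ffunE.
  move: (hc); rewrite entryE => /orP[] /eqP hce; subst e; last first.
    have ho : on (other c) by apply/existsP; exists i.
    by rewrite ho andbF in hEc; rewrite (strand_local _ hEc); exact: step_other.
  have hon : on (side c) by apply/existsP; exists i.
  move: hEc; rewrite hon /=.
  (* When both entering edges are used, the path through [other c] takes its own
     strand, so a jump from [side c] would land on it. *)
  have [/existsP[j hj] hEc|hno] := boolP (on (other c)).
    rewrite (strand_local _ hEc).
    have [e2 [h2 hs2 hx2]] := is_path_next (hP j) hj (other_entry c).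
    have [//|hne] := eqVneq e' (strand D c (side c)).
    have hd : e' = e2.
      have [s hs1 hs1'] := strand_onto D hx.
      move: hs1; rewrite entryE => /orP[] /eqP h1; subst s.
        by rewrite hs1' eqxx in hne.
      by rewrite (step_other hs2) hs1'.
    subst e2; have hij := disj _ _ _ he' h2; subst j.
    have := is_path_depth_inj (hP i) he hj (entry_same (side_entry c) (other_entry c)).
    by move/eqP; rewrite (negPf (side_other c)).
  have two (F : pipe_dream la) : F c <> E c -> e' <> strand E c (side c) ->
      e' = strand F c (side c).
    move=> hF hne; have [s hs1 hs1'] := strand_onto E hx.
    move: hs1; rewrite entryE => /orP[] /eqP h1; subst s; first by case: hne.
    by rewrite (strand_swap (side_entry c) (other_entry c) (side_other c) hF).
  (* Alone in the cell, the path uses just one exit, so testing the elbow's exit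
     identifies the one it uses. *)
  case: ifP => hb hEc; apply/eqP/negPn/negP=> /eqP hne.
    have hbi : bend c = strand E c (side c) by apply/esym/bendE.
    case/existsP: hb => j hj.
    have hxb : exit c (bend c) by rewrite hbi strand_exit.
    have [e0 [h0 hs0 hc0]] := is_path_prev (hP j) hj hxb.
    move: hc0; rewrite entryE => /orP[] /eqP h1; subst e0; last first.
      by case/negP: hno; apply/existsP; exists j.
    have hij := disj _ _ _ he h0; subst j.
    by apply: hne; rewrite -hbi; exact: is_path_depth_inj (hP i) he' hj (exit_same hx hxb).
  have := two [ffun=> Elbow]; rewrite hEc ffunE => /(_ _ hne) h.
  have hbend : e' = bend c by rewrite h //; apply/bendE; rewrite ffunE.
  by move/negbT/existsP: hb; case; exists i; rewrite -hbend.
have pipesE i : pipe_from E (src i) = S i.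
  have [] := hS i; case hSi: (S i) => [|e q] //= /and3P[_ hp hl] /eqP[<-].
  by rewrite (follow i q e) // => x; rewrite hSi.
have onE e : on_pipes src E e = on e by apply: eq_existsb => i; rewrite pipesE.
exists E; last by apply/ffunP=> i; rewrite ffunE pipesE.
move=> c hne.
have [hs ho] : on (side c) /\ ~~ on (other c).
  by move: hne; rewrite ffunE; case: ifP => // /andP[].
rewrite !onE hs ho; split=> //; apply/negP=> hw; apply: hne.
case/existsP: (hs) => i hi.
have [e' [he' hs' hx']] := is_path_next (hP i) hi (side_entry c).
have hst : strand E c (side c) \in S i.
  by rewrite -pipesE mem_pipe_strand // pipesE.
have h : strand E c (side c) = strand D c (side c).
  rewrite -(step_white hw hs').
  exact: is_path_depth_inj (hP i) hst he' (exit_same (strand_exit _ _ _) hx').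
(* Equal exits force equal tiles. *)
apply/eqP/negPn/negP=> /eqP hne'.
move/eqP: (side_other c); apply; apply: (@strand_inj _ _ _ D c) => //.
by rewrite -h; apply: strand_swap.
Qed.

Lemma pipes_bij : set_bij free_changes path_systems pipes.
Proof.
split; first exact: pipes_system.
  by move=> E E'; rewrite !inE; exact: pipes_inj.
by move=> S /pipes_onto[E hE <-]; exists E.
Qed.

End Systems.

(** * Restricted diagrams *)

Section Restricted.
Variables (k m : nat) (la : 'I_k -> 'I_m.+1).
Hypothesis hla : is_partition la.
Variable D : pipe_dream la.
Hypothesis hD : go_diagram D.

Implicit Types (c p : cell la) (e : edge) (E : pipe_dream la) (T : {set cell la}).

(** An elbow sends the east pipe north and the south pipe west, and the Go condition
orders them; a crossing sends the east pipe west, and it is black when that pipe has the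
larger index. *)
Lemma nonwhite_order c : ~~ white D c = (pipe_index D (north c) < pipe_index D (west c)).
Proof.
rewrite -(pipe_index_strand D (north_entry c)) -(pipe_index_strand D (west_entry c)).
rewrite strand_north strand_west /white.
have := exit_pipes_neq hla D c; have := @hD c; rewrite /east_pipe /south_pipe.
by case: (D c) => /= hgo hne; move: hne; case: ltngtP => // h _; case: hgo.
Qed.

Lemma path_stepP r c e e' : entry c e -> path_step r D e e' ->
  e' = strand D c e \/
  exists f, [/\ entry c f, f != e, ~~ white D c, r (pipe_index D f) (pipe_index D e)
              & e' = strand D c f].
Proof.
move=> hc /existsP[c' /andP[hc' h]]; rewrite -(entry_cell hc hc') {c' hc'} in h.
case/orP: h => [/eqP|/and4P[hpb hx hne hr]]; first by left.
right; have hx' : exit c e' by rewrite /exit; move: hx; rewrite !inE.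
have [f hf hs] := strand_onto D hx'; exists f; split=> //.
- by apply: contraNneq hne => <-; rewrite hs.
- by move: hpb; rewrite /plus /black /white; case: (D c) => //=; rewrite -leqNgt; exact: ltnW.
by rewrite -(pipe_index_strand D hf) hs.
Qed.

Lemma path_step_jump (r : rel nat) c e f : entry c e -> entry c f -> f != e ->
  ~~ white D c -> r (pipe_index D f) (pipe_index D e) -> path_step r D e (strand D c f).
Proof.
move=> he hf hfe hw hr; apply/existsP; exists c; rewrite -/(entry c e) he /=.
apply/orP; right; apply/and4P; split.
- move: hw; rewrite /white /plus /black; have := exit_pipes_neq hla D c.
  by case: (D c) => //=; case: ltngtP.
- by have := strand_exit D c f; rewrite /exit !inE.
- by apply: contraNneq hfe => /(strand_inj hf he) ->.
by rewrite pipe_index_strand.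
Qed.

Lemma exit_strandE c e f e' : entry c e -> entry c f -> e != f -> exit c e' ->
  e' = strand D c e \/ e' = strand D c f.
Proof.
move=> he hf hef hx; have [s hs <-] := strand_onto D hx.
by move: he hf hef hs; rewrite /entry => /orP[] /eqP -> /orP[] /eqP ->;
   rewrite ?eqxx // => _ /orP[] /eqP ->; auto.
Qed.

Definition west_changes := free_changes D (@west_boundary k) (@west k m la) (@north k m la).

Lemma west_changes_bij :
  set_bij west_changes (restricted_systems D) (@west_pipes k m la).
Proof.
have nw c : north c != west c by [].
apply: pipes_bij => //.
- exact: west_in_nw.
- by move=> i j [] /val_inj.
- by move=> c e; rewrite /entry orbC.
- move=> c e' hw hx.
  case: (exit_strandE (north_entry c) (west_entry c) (nw c) hx) => ->.
    by apply: path_step_jump; rewrite ?north_entry ?west_entry //= -nonwhite_order.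
  by apply: path_step_strand; exact: west_entry.
- move=> c e' hw /(path_stepP (west_entry c)) [//|[f [_ _ hw' _ _]]].
  by rewrite hw in hw'.
move=> c e' /(path_stepP (north_entry c)) [//|[f [hf hne hw hr _]]].
move: hf hr; rewrite /entry (negPf hne) /= => /eqP ->.
by rewrite nonwhite_order in hw; rewrite ltnNge ltnW.
Qed.

Lemma north_changes_bij :
  set_bij west_changes (dual_restricted_systems D) (@north_pipes k m la).
Proof.
have wn c : west c != north c by [].
have -> : west_changes =
    free_changes D (@north_boundary m) (@north k m la) (@west k m la).
  have hn E c := on_northE hla E (entry_in_diagram hla (north_entry c)).
  have hw E c := on_northE hla E (entry_in_diagram hla (west_entry c)).
  apply/seteqP; split=> E hE c /hE[hD' h1 h2]; split=> //.
  - by have := hn E c; rewrite /on_north => ->.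
  - by have := hw E c; rewrite /on_north => ->; rewrite negbK.
  - by have := hw E c; rewrite /on_north (negPf h2) => /esym/negbFE.
  by have := hn E c; rewrite /on_north h1 => /esym.
apply: pipes_bij => //.
- exact: north_in_nw.
- by move=> i j [] /val_inj.
- move=> c e' hw hx.
  case: (exit_strandE (west_entry c) (north_entry c) (wn c) hx) => ->.
    by apply: path_step_jump; rewrite ?north_entry ?west_entry //= -nonwhite_order.
  by apply: path_step_strand; exact: north_entry.
- move=> c e' hw /(path_stepP (north_entry c)) [//|[f [_ _ hw' _ _]]].
  by rewrite hw in hw'.
move=> c e' /(path_stepP (west_entry c)) [//|[f [hf hne hw hr _]]].
move: hf hr; rewrite /entry (negPf hne) orbF => /eqP -> /=.
by rewrite nonwhite_order in hw; rewrite ltnNge ltnW.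
Qed.

(** ** Togglable cells *)

Lemma before_weakly_NW c p e : entry c e -> before p e -> weakly_NW p c.
Proof. by rewrite /weakly_NW => /orP[] /eqP -> /=; lia. Qed.

Lemma after_weakly_NW p c e : entry p e -> after c e -> weakly_NW p c.
Proof. by rewrite /weakly_NW => /orP[] /eqP -> /=. Qed.

Lemma perm_eq_pair (T : eqType) (a b x y : T) : perm_eq [:: a; b] [:: x; y] ->
  (a = x /\ b = y) \/ (a = y /\ b = x).
Proof.
move=> h; have := perm_mem h a; rewrite !inE eqxx /= => /esym/orP[] /eqP ha; subst a.
  left; split=> //; move: h; rewrite perm_cons => /perm_mem/(_ b).
  by rewrite !inE eqxx => /esym/eqP.
right; split=> //; move: h => /perm_trans/(_ (permEl (perm_catC [:: x] [:: y]))).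
rewrite perm_cons => /perm_mem/(_ b).
by rewrite !inE eqxx => /esym/eqP.
Qed.

Lemma entry_exit_indices E p :
  (pipe_index E (west p) = east_pipe E p /\ pipe_index E (north p) = south_pipe E p) \/
  (pipe_index E (west p) = south_pipe E p /\ pipe_index E (north p) = east_pipe E p).
Proof.
rewrite -(pipe_index_strand E (north_entry p)) -(pipe_index_strand E (west_entry p)).
by rewrite strand_north strand_west; case: (E p); [left|right].
Qed.

(** The freedom condition of [west_changes] at one cell, shaped so that the two
unfold to the same triple. *)
Definition west_over_north E p : Prop :=
  [/\ ~~ white D p, on_west E (west p) & ~~ on_west E (north p)].

(** The pipes meeting at [p] have their indices from [D], where non-white means that
the west one is the larger; that is also when exchanging a west label with a north label
adds inversions.  So the length condition decides which of the two labels sits on which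
boundary. *)
Lemma togglableP E T p : (forall c, c \notin T -> E c = D c) ->
  [disjoint T & cell_in p] -> togglable D E T p <-> west_over_north E p.
Proof.
move=> hE hT.
have hloc e : entry p e -> pipe_index E e = pipe_index D e.
  move=> he; apply: pipe_index_local => c hc; apply: hE.
  apply/negP=> hcT; have := disjointFr hT hcT.
  by rewrite inE (after_weakly_NW he hc).
have hw := entry_in_diagram hla (west_entry p).
have hn := entry_in_diagram hla (north_entry p).
have hlt : ~~ white D p = (pipe_index E (north p) < pipe_index E (west p)).
  by rewrite nonwhite_order !hloc ?north_entry ?west_entry.
have hperm : perm_eq [:: pipe_index E (west p); pipe_index E (north p)]
    [:: east_pipe E p; south_pipe E p].
  case: (entry_exit_indices E p) => -[-> ->] //.
  by rewrite perm_sym; exact: (permEl (perm_catC [:: _] [:: _])).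
have hswap : permutation (toggle E p) =
    [seq swap (pipe_index E (west p)) (pipe_index E (north p)) x | x <- permutation E].
  rewrite permutation_toggle //; apply: eq_map => x.
  by case: (entry_exit_indices E p) => -[-> ->] //; exact: swapC.
split=> [[[b [c [hbc hb hc hs]]] hinv _ hwh]|[hwh h1 h2]].
- move: hinv; rewrite hs inversions_swap ?permutation_uniq // => hcb.
  rewrite hlt in hwh.
  have hpair : b = pipe_index E (west p) /\ c = pipe_index E (north p).
    rewrite perm_sym in hperm; case: (perm_eq_pair (perm_trans hbc hperm)) => -[? ?] //.
    by subst; lia.
  case: hpair hb hc => -> ->; rewrite mem_west_labels // mem_north_labels // on_northE //.
  by split; rewrite ?hlt.
have hmw : pipe_index E (west p) \in west_labels E by rewrite mem_west_labels.
have hmn : pipe_index E (north p) \in north_labels E.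
  by rewrite mem_north_labels // on_northE.
split=> //.
  by exists (pipe_index E (west p)), (pipe_index E (north p)).
by rewrite hswap inversions_swap ?permutation_uniq // -hlt.
Qed.

Lemma on_west_toggle E p c e : entry c e -> ~~ before p e ->
  on_west (toggle E p) e = on_west E e.
Proof.
move=> hc hb; apply: on_pipes_local => [i|c' hc']; first exact: west_in_nw.
by apply: toggle_other; apply: contraNneq hb => <-.
Qed.

(** A later toggle is never to the north-west of an earlier one, so it does not alter
the colours that made the earlier one possible. *)
Lemma reachable_changes E T : toggle_reachable D E T ->
  (forall c, c \notin T -> E c = D c) /\ (forall c, c \in T -> west_over_north E c).
Proof.
elim=> [|{}E {}T p _ [hE hT] htog]; first by split=> // c; rewrite inE.
have hdis : [disjoint T & cell_in p] by case: htog.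
split=> c; rewrite !inE.
  by rewrite negb_or => /andP[hcp /hE <-]; exact: toggle_other.
have nb : c = p \/ c \in T -> forall e, entry c e -> ~~ before p e.
  case=> [-> e|hc e he]; first exact: before_entry_neq.
  apply/negP=> hb; have := disjointFr hdis hc.
  by rewrite inE (before_weakly_NW he hb).
move=> hc; have hc' : c = p \/ c \in T by case/predU1P: hc; auto.
rewrite /west_over_north !(@on_west_toggle E p c) ?nb ?west_entry ?north_entry //.
by case: hc' => [->|/hT //]; apply/(togglableP hE hdis).
Qed.

(** Undo a changed cell of maximal depth: no other changed cell has it to its
north-west, so the rest stays free, and no other changed cell is to its south-east, so it
can be toggled last. *)
Lemma changes_reachable E : west_changes E ->
  toggle_reachable D E [set c | E c != D c].
Proof.
have [n] := ubnP #|[set c | E c != D c]|; elim: n E => // n IH E hn hE.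
have [h0|[p0 hp0]] := set_0Vmem [set c | E c != D c].
  rewrite h0; have -> : E = D; last exact: Reach_start.
  apply/ffunP=> c; apply/eqP/negPn/negP=> hc.
  by have /setP/(_ c) := h0; rewrite !inE hc.
have [p hp hmax] := arg_maxnP (fun c => row c + col c) hp0.
have {}hp : E p != D p by have : p \in [set c | E c != D c] := hp; rewrite inE.
have last c : E c != D c -> weakly_NW p c -> c = p.
  move=> hc /andP[hr hl].
  have hle : row c + col c <= row p + col p.
    by apply: hmax; change (c \in [set c | E c != D c]); rewrite inE.
  by apply: cell_eq; lia.
pose F := toggle E p.
have Fp : F p = D p by rewrite /F toggleE; move: hp; case: (E p); case: (D p).
have FT : [set c | F c != D c] = [set c | E c != D c] :\ p.
  apply/setP=> c; rewrite !inE; have [->|hcp] := eqVneq c p; first by rewrite Fp eqxx.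
  by rewrite /F toggle_other.
have FE c : F c != D c -> west_over_north F c.
  have [->|hcp] := eqVneq c p; first by rewrite Fp eqxx.
  rewrite /F toggle_other // => hc.
  have nb e : entry c e -> ~~ before p e.
    move=> he; apply/negP=> /(before_weakly_NW he)/(last c hc) h.
    by rewrite h eqxx in hcp.
  rewrite /west_over_north !(@on_west_toggle E p c) ?nb ?west_entry ?north_entry //.
  by apply: hE; apply/eqP.
have hp' : p \in [set c | E c != D c] by rewrite inE.
have hreach : toggle_reachable D F [set c | F c != D c].
  apply: IH => [|c /eqP]; last exact: FE.
  by move: hn; rewrite FT (cardsD1 p) hp'.
rewrite -(finset.setD1K hp') -FT -[X in toggle_reachable D X](toggleK E p) -/F.
apply: Reach_toggle hreach _; apply/togglableP.
- by move=> c; rewrite inE negbK => /eqP.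
- rewrite disjoint_subset; apply/fintype.subsetP=> c; rewrite FT !inE => /andP[hcp hc].
  by apply: contraNN hcp => /(last c hc) ->.
rewrite /west_over_north !(@on_west_toggle E p p) ?before_entry_neq ?west_entry ?north_entry //.
by apply: hE; apply/eqP.
Qed.

Lemma restricted_diagrams_changes : restricted_diagrams D = west_changes.
Proof.
apply/seteqP; split=> [E [T /reachable_changes[hE hT]] c hc|E hE].
  by apply: hT; apply: contra_notT hc => /hE.
by exists [set c | E c != D c]; exact: changes_reachable.
Qed.

End Restricted.

Theorem theorem3p25 (n k : nat) (hkn : k <= n) (la : 'I_k -> 'I_(n - k).+1)
    (hla : is_partition la) (D : pipe_dream la) (hD : go_diagram D) :
  set_bij (restricted_diagrams D) (restricted_systems D) (@west_pipes k (n - k) la) /\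
  set_bij (restricted_diagrams D) (dual_restricted_systems D) (@north_pipes k (n - k) la).
Proof.
rewrite restricted_diagrams_changes //.
by split; [exact: west_changes_bij | exact: north_changes_bij].
Qed.
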